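(* For every complete linear ordering $\alpha$, every finite semigroup $(S,\cdot)$ and every additive labelling $\sigma$ from $\alpha$ to $S$, there exists a ramseyan split for $(\alpha,\sigma)$ of height at most $3|S|$; moreover, if $\alpha$ is an ordinal (a well-ordering), there exists one of height at most $|S|$.
   Context: A linear ordering is complete if every nonempty subset with an upper bound has a least upper bound in it and every nonempty subset with a lower bound has a greatest lower bound in it. An additive labelling from a linear ordering $\alpha$ to a semigroup $S$ is a map $\sigma$ assigning to every pair $(x,y)$ with $x<y$ in $\alpha$ an element $\sigma(x,y)\in S$, such that $\sigma(x,y)\sigma(y,z)=\sigma(x,z)$ for all $x<y<z$. A split of height $N$ of $\alpha$ is a map $s\colon\alpha\to\{1,\dots,N\}$. Two elements $x,y$ with $s(x)=s(y)=k$ are $k$-neighbours if $s(z)\ge k$ for all $z$ between them (inclusive). The split is ramseyan for $(\alpha,\sigma)$ if for every $k$ and all $x<y$, $x'<y'$ such that $x,y,x',y'$ are all $k$-neighbours of one another, $\sigma(x,y)=\sigma(x',y')=\sigma(x,y)^2$. *)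

(* Defs.v *)
From mathcomp Require Import all_boot all_order.
From mathcomp Require Export boolp classical_sets wochoice.

Set Implicit Arguments.
Unset Strict Implicit.
Unset Printing Implicit Defensive.

Local Open Scope order_scope.

Definition complete_order (d : Order.disp_t) (alpha : orderType d) : Prop :=
  (forall A : set alpha, has_sup A -> (supremums A !=set0)%classic) /\
  (forall A : set alpha, has_inf A -> (infimums A !=set0)%classic).

(* A labelling is a total binary function; its values outside the pairs x < y
   are irrelevant, here and in [ramseyan]. *)
Definition additive_labelling (d : Order.disp_t) (alpha : orderType d)
    (S : Type) (mul : SemiGroup.law S) (sigma : alpha -> alpha -> S) : Prop :=
  forall x y z : alpha, x < y -> y < z ->
    mul (sigma x y) (sigma y z) = sigma x z.

Definition is_split (T : Type) (N : nat) (s : T -> nat) : Prop :=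
  forall x : T, (1 <= s x <= N)%N.

(* x and y may come in either order, hence the min and max. *)
Definition neighbours (d : Order.disp_t) (alpha : orderType d)
    (s : alpha -> nat) (k : nat) (x y : alpha) : Prop :=
  [/\ s x = k, s y = k &
      forall z : alpha, Order.min x y <= z <= Order.max x y -> (k <= s z)%N].

Definition ramseyan (d : Order.disp_t) (alpha : orderType d)
    (S : Type) (mul : SemiGroup.law S) (sigma : alpha -> alpha -> S)
    (s : alpha -> nat) : Prop :=
  forall (k : nat) (x y x' y' : alpha), x < y -> x' < y' ->
    {in [:: x; y; x'; y'] &, forall u v : alpha, neighbours s k u v} ->
    sigma x y = sigma x' y' /\ sigma x y = mul (sigma x y) (sigma x y).

(* Main.v *)
Require Import Defs.
From mathcomp Require Import all_boot all_order.

(* Induction on the ideal K containing the labels of a subset X. Let I be a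
   maximal ideal properly inside K, so that J = K \ I is a J-class. Take Y inside
   X, maximal among the subsets whose labels lie in I: by induction it has a
   split using few small values, and X \ Y remains to be coloured with large
   values. By maximality each x in X \ Y has a label in J with some base in Y,
   which must be the closest point of Y below or above x. The points sharing a
   base below have all their labels in J, so by Green's relations they can be
   coloured by elements of J in such a way that the labels between points of one
   colour are a single idempotent; the points with a base above are handled by
   duality. This costs 2|J| colours. In a well-order Y can be chosen greedily,
   all bases are below, and |J| colours suffice. If I is empty, take Y empty and
   split X at a point, which has to be the minimum in a well-order. *)

Set Implicit Arguments.
Unset Strict Implicit.
Unset Printing Implicit Defensive.

Import Order.TTheory.

(** * Ideals and chief factors of a finite semigroup *)

Definition ideal (S : finType) (mul : S -> S -> S) (I : {set S}) :=
  forall a b, a \in I -> (mul a b \in I) /\ (mul b a \in I).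

(** Membership of [b] in the principal ideal S^1 a S^1; the four cases stand for the adjoined
    identity. *)
Definition two_sided_multiple (S : finType) (mul : S -> S -> S) (a b : S) :=
  [\/ b = a, exists u, b = mul u a, exists v, b = mul a v
    | exists u v, b = mul (mul u a) v].

(* There is no ideal strictly between I and K, so that K :\: I is a single
   J-class; this formulation is visibly self-dual. *)
Definition chief (S : finType) (mul : S -> S -> S) (K I : {set S}) :=
  [/\ ideal mul K, ideal mul I &
    forall a b, a \in K :\: I -> b \in K :\: I -> two_sided_multiple mul a b].

Definition opp_mul (S : Type) (mul : S -> S -> S) (a b : S) := mul b a.

Section FiniteSemigroup.
Variables (S : finType) (mul : S -> S -> S).
Hypothesis mulA : associative mul.
Local Notation "a ** b" := (mul a b) (at level 40, left associativity).

Lemma opp_mulA : associative (opp_mul mul).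
Proof. by move=> a b c; rewrite /opp_mul mulA. Qed.

Lemma chief_opp (K I : {set S}) : chief mul K I -> chief (opp_mul mul) K I.
Proof.
case=> idK idI gen; split=> [a b /(idK a b)[]|a b /(idI a b)[]|a b Ja Jb] //.
case: (gen _ _ Ja Jb) => [->|[u ->]|[v ->]|[u [v ->]]].
- exact: Or41.
- by apply: Or43; exists u.
- by apply: Or42; exists v.
- by apply: Or44; exists v, u; rewrite /opp_mul mulA.
Qed.

(** Take [I] maximal among the ideals properly inside [K]. For a in K \ I, the union of [I] with the
    principal ideal of a must be all of [K], so that principal ideal contains K \ I. *)
Lemma exists_chief (K : {set S}) : ideal mul K -> K != set0 ->
  exists I, chief mul K I /\ I \proper K.
Proof.
move=> idK K0; pose P (I : {set S}) := `[< ideal mul I >] && (I \proper K).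
have P0 : P set0.
  by rewrite /P proper0 K0 andbT; apply/asboolP => a b; rewrite inE.
have [I /maxsetP[/andP[/asboolP idI ltIK] maxI] _] := maxset_exists P0.
exists I; split=> //; split=> // a b aJ bJ.
pose M := [set x | `[< two_sided_multiple mul a x >]].
have idM : ideal mul M.
  move=> x y; rewrite !inE => /asboolP ax; split; apply/asboolP.
    case: ax => [->|[u ->]|[v ->]|[u [v ->]]].
    - by apply: Or43; exists y.
    - by apply: Or44; exists u, y.
    - by apply: Or43; exists (v ** y); rewrite mulA.
    - by apply: Or44; exists u, (v ** y); rewrite mulA.
  case: ax => [->|[u ->]|[v ->]|[u [v ->]]].
  - by apply: Or42; exists y.
  - by apply: Or42; exists (y ** u); rewrite mulA.
  - by apply: Or44; exists y, v; rewrite mulA.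
  - by apply: Or44; exists (y ** u), v; rewrite !mulA.
have aM : a \in M by rewrite inE; apply/asboolP; exact: Or41.
have [aI aK] : a \notin I /\ a \in K by move: aJ; rewrite inE => /andP[].
have [bI bK] : b \notin I /\ b \in K by move: bJ; rewrite inE => /andP[].
have MK : M \subset K.
  apply/subsetP=> x; rewrite inE => /asboolP.
  case=> [->//|[u ->]|[v ->]|[u [v ->]]]; first by have [] := idK a u aK.
    by have [] := idK a v aK.
  by rewrite -mulA; have [avK _] := idK a v aK; have [] := idK _ u avK.
have idU : ideal mul (I :|: M).
  move=> x y; rewrite !in_setU.
  by case/orP=> [/idI|/idM] /(_ y)[-> ->]; rewrite ?orbT.
have : I :|: M = K.
  apply/eqP; rewrite eqEproper subUset MK (proper_sub ltIK) /=.
  apply: contraNN aI => ltK.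
  rewrite -(maxI (I :|: M)) ?subsetUl // ?in_setU ?aM ?orbT //.
  by rewrite /P ltK andbT; apply/asboolP.
by move/setP/(_ b); rewrite bK in_setU (negPf bI) inE => /asboolP.
Qed.

(** The sequence a t^n repeats by finiteness, and multiplying by u on the left moves it one step
    back. Hence it returns to a itself after a positive number of steps. *)
Lemma absorb_period a u t : a = (u ** a) ** t -> exists w, a = (a ** t) ** w.
Proof.
move=> aE; pose F n := iter n (mul^~ t) a.
have [i [j [ltij Fij]]] : exists i j, i < j /\ F i = F j.
  pose F' (i : 'I_#|S|.+1) := F i.
  have : ~~ injectiveb F'.
    by apply/negP=> /injectiveP/leq_card; rewrite card_ord ltnn.
  case/injectivePn=> i [j neq Fij].
  case: (ltngtP i j) => [ltij|ltij|/val_inj eij].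
  - by exists i, j.
  - by exists j, i.
  - by rewrite eij eqxx in neq.
have uF n : u ** F n.+1 = F n.
  by elim: n => [|n IH]; rewrite /= mulA -?aE // IH.
have back n m : iter n (mul u) (F (m + n)) = F m.
  by elim: n => [|n IH]; rewrite ?addn0 // addnS iterSr uF.
have aper : F (j - i) = a.
  by rewrite -(back i) subnK ?(ltnW ltij) // -Fij (back i 0).
have Fw n : exists w, F n.+2 = a ** t ** w.
  elim: n => [|n [w IH]]; first by exists t.
  by exists (w ** t); rewrite -[LHS]/(F n.+2 ** t) IH mulA.
move: ltij; rewrite -subn_gt0; case: (j - i) aper => // -[|n] aper _.
  by exists t; have at1 : a ** t = a := aper; rewrite !at1.
by have [w Fn] := Fw n; exists w; rewrite -Fn.
Qed.

(** * Stability: one-sided multiples that stay inside the J-class *)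

Section ChiefFactor.
Variables K I : {set S}.
Hypothesis KI : chief mul K I.

(** As a and a b are J-equivalent, a = u a b v for some u, v, possibly trivial; [absorb_period] then
    removes the left factor u. *)
Lemma chief_stable a b : a \in K :\: I -> a ** b \in K :\: I ->
  exists w, a ** b ** w = a.
Proof.
move=> Ja Jab; case: KI => _ _ /(_ _ _ Jab Ja)[aE|[u aE]|[v aE]|[u [v aE]]].
- by exists b; rewrite -!aE.
- by have [|w aw] := @absorb_period a u b; [rewrite -mulA | exists w].
- by exists v.
have [|w aw] := @absorb_period a u (b ** v); first by rewrite {1}aE !mulA.
by exists (v ** w); rewrite [RHS]aw !mulA.
Qed.

Lemma chief_factorl a b : a \in K -> a ** b \in K :\: I -> a \in K :\: I.
Proof.
case: KI => _ idI _ aK; rewrite !inE aK => /andP[abI _]; rewrite andbT.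
by apply: contraNN abI => /(idI a b)[].
Qed.

End ChiefFactor.
End FiniteSemigroup.

Section FiniteSemigroupDual.
Variables (S : finType) (mul : S -> S -> S) (K I : {set S}).
Hypotheses (mulA : associative mul) (KI : chief mul K I).
Local Notation "a ** b" := (mul a b) (at level 40, left associativity).

Lemma chief_stablel a b : b \in K :\: I -> a ** b \in K :\: I ->
  exists w, w ** (a ** b) = b.
Proof.
move=> Jb Jab.
exact: (chief_stable (opp_mulA mulA) (chief_opp mulA KI) (b := a) Jb Jab).
Qed.

Lemma chief_factorr a b : b \in K -> a ** b \in K :\: I -> b \in K :\: I.
Proof. move=> bK Jab; exact: (chief_factorl (chief_opp mulA KI) bK Jab). Qed.

End FiniteSemigroupDual.

(* [additive_labelling] for a bare function, so that it applies to [opp_mul]. *)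
Definition is_labelling (d : Order.disp_t) (alpha : orderType d) (S : Type)
    (mul : S -> S -> S) (sigma : alpha -> alpha -> S) :=
  forall x y z : alpha, (x < y)%O -> (y < z)%O ->
    mul (sigma x y) (sigma y z) = sigma x z.

(** * Colouring points whose labels all lie in one J-class *)

Section Smooth.
Variables (S : finType) (mul : S -> S -> S) (K I : {set S}).
Hypotheses (mulA : associative mul) (KI : chief mul K I).
Local Notation "a ** b" := (mul a b) (at level 40, left associativity).
Variables (d : Order.disp_t) (alpha : orderType d).
Variable sigma : alpha -> alpha -> S.
Hypothesis sigmaM : is_labelling mul sigma.
Variables (D : alpha -> Prop) (a : alpha -> S).
(* For points above a common base y, a is [sigma y]; no such y exists when K is
   the minimal ideal. *)
Hypothesis aJ : forall x, D x -> a x \in K :\: I.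
Hypothesis sigmaK : forall x y, D x -> D y -> (x < y)%O -> sigma x y \in K.
Hypothesis aM : forall x y, D x -> D y -> (x < y)%O -> a x ** sigma x y = a y.

(* The idempotents e that are L-equivalent to the labels ending in x and
   R-equivalent to the labels starting in x: they single out a group H-class. *)
Let idem_at x e := [/\ e \in K :\: I, e ** e = e, a x ** e = a x &
  forall y, D y -> (x < y)%O -> e ** sigma x y = sigma x y].

Let sigmaJ x y : D x -> D y -> (x < y)%O -> sigma x y \in K :\: I.
Proof.
move=> Dx Dy lt; apply: (chief_factorr mulA KI (a := a x)); first exact: sigmaK.
by rewrite aM ?aJ.
Qed.

(** Stability gives w with (a x) b w = a x. Then b w fixes a x on the right and is a left multiple
    of it, hence is idempotent. It is R-equivalent to b, and so to every label starting at x, which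
    it therefore fixes on the left. *)
Let idem_at_lt x y : D x -> D y -> (x < y)%O -> exists e, idem_at x e.
Proof.
move=> Dx Dy lt; have bJ := sigmaJ Dx Dy lt; set b := sigma x y in bJ.
have [|w aw] := chief_stable mulA KI (b := b) (aJ Dx); first by rewrite aM ?aJ.
have eJ : b ** w \in K :\: I.
  apply: (chief_factorr mulA KI (a := a x)); last by rewrite mulA aw aJ.
  by have [idK _ _] := KI; move: bJ; rewrite inE => /andP[_ /(idK b w)[]].
have [|p pE] := chief_stablel mulA KI (a := a x) eJ.
  by rewrite mulA aw aJ.
have ee : b ** w ** (b ** w) = b ** w.
  have aE : a x ** (b ** w) = a x by rewrite mulA.
  by rewrite aE in pE; rewrite -{1}pE -mulA aE.
have [z zE] := chief_stable mulA KI bJ eJ.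
have eb : b ** w ** b = b by rewrite -{2}zE mulA ee zE.
exists (b ** w); split=> //; first by rewrite mulA aw.
move=> y' Dy' lt'; case: (ltgtP y y') => [yy'|yy'|<-//].
  by rewrite -(sigmaM lt yy') mulA eb.
have [|v vE] := chief_stable mulA KI (b := sigma y' y) (sigmaJ Dx Dy' lt').
  by rewrite (sigmaM lt' yy').
by rewrite -vE (sigmaM lt' yy') mulA eb.
Qed.

(** The new case is a last point x of [D], where no label starts. If e0 is an idempotent for y and b
    v = e0, then v b is an idempotent fixing a x on the right. *)
Let idem_at_gt x y : D x -> D y -> (y < x)%O -> exists e, idem_at x e.
Proof.
move=> Dx Dy lt.
have [[z [Dz xz]]|nz] := pselect (exists z, D z /\ (x < z)%O).
  exact: idem_at_lt xz.
have [e0 [e0J e0e0 ae0 e0s]] := idem_at_lt Dy Dx lt.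
have bJ := sigmaJ Dy Dx lt; have e0b := e0s _ Dx lt.
have ab := aM Dy Dx lt; set b := sigma y x in bJ e0b ab.
have [|v bv] := chief_stable mulA KI (b := b) e0J; first by rewrite e0b.
rewrite e0b in bv; exists (v ** b); split.
- apply: (chief_factorr mulA KI (a := b)); last by rewrite mulA bv e0b.
  by have [idK _ _] := KI; move: bJ; rewrite inE => /andP[_ /(idK b v)[]].
- by rewrite -mulA (mulA b) bv e0b.
- by rewrite -ab -mulA (mulA b) bv e0b.
- by move=> z Dz xz; case: nz; exists z.
Qed.

(** If x < y have the same colour, then E x = E y and f x absorbs [sigma x y] on the right;
    cancelling f x in the group of E x leaves [sigma x y] = E x. *)
Lemma smooth_colouring : exists f : alpha -> S,
  (forall x, D x -> f x \in K :\: I) /\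
  forall c, exists e, forall x y, D x -> D y -> (x < y)%O ->
    f x = c -> f y = c -> sigma x y = e /\ e ** e = e.
Proof.
pose has_idem x := exists e, idem_at x e.
have [E EP] : {E : alpha -> S & forall x, has_idem x -> idem_at x (E x)}.
  apply: (@choice _ _ (fun x e => has_idem x -> idem_at x e)) => x.
  have [[e xe]|nxe] := pselect (has_idem x); first by exists e.
  by exists (a x) => xe; case: nxe.
(* [U e] comes from one reference point per idempotent, so all points attached to e are translated
   by the same factor. *)
pose based e u := exists x, [/\ D x, idem_at x e & u ** a x = e].
pose group e := exists x, D x /\ idem_at x e.
have [U UP] : {U : S -> S & forall e, group e -> based e (U e)}.
  apply: (@choice _ _ (fun e u => group e -> based e u)) => e.
  have [[x [Dx xe]]|nxe] := pselect (group e); last first.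
    by exists e => xe; case: nxe.
  have [eJ ee axe _] := xe.
  have [|w wE] := chief_stablel mulA KI (a := a x) eJ; first by rewrite axe aJ.
  by exists w => _; exists x; split=> //; rewrite -axe.
(* Multiplying by U e maps the H-class of a x into the group with identity e. *)
pose f x := if pselect (has_idem x) then U (E x) ** a x else a x.
have fP x : D x -> has_idem x ->
    [/\ f x \in K :\: I, f x = U (E x) ** a x, f x ** E x = f x,
      exists p, f x ** p = E x & exists q, q ** f x = E x].
  move=> Dx xe; have [eJ ee axe es] := EP _ xe.
  have fE : f x = U (E x) ** a x by rewrite /f; case: pselect.
  have [|x0 [Dx0 [_ _ _ e0s] u0]] := UP (E x).
    by exists x; split; last exact: EP.
  (* Whichever of x and the reference point x0 comes first, the label between them relates [a x] to
     [a x0]. *)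
  have [p pE] : exists p, f x ** p = E x.
    rewrite fE; case: (ltgtP x x0) => [lt|lt|x0x].
    - by exists (sigma x x0); rewrite -mulA aM.
    - rewrite -(aM Dx0 Dx lt) mulA u0.
      by apply: (chief_stable mulA KI eJ); rewrite e0s ?sigmaJ.
    - have ax : a x = a x0 by rewrite x0x.
      by exists (E x); rewrite ax u0 ee.
  have fJ : f x \in K :\: I.
    apply: (chief_factorl KI (b := p)); last by rewrite pE.
    have [idK _ _] := KI; have := aJ Dx.
    by rewrite fE inE => /andP[_ /(idK (a x) (U (E x)))[]].
  have fe : f x ** E x = f x by rewrite fE -mulA axe.
  split=> //; first by exists p.
  have [|q qE] := chief_stablel mulA KI (a := f x) eJ; first by rewrite fe.
  by exists q; rewrite -{1}fe.
(* f x is H-equivalent to E x, and an H-class contains at most one idempotent. *)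
have Einj x y : D x -> D y -> has_idem x -> has_idem y ->
    f x = f y -> E x = E y.
  move=> Dx Dy xe ye fxy; have [fJ _ fe [p pE] [q qE]] := fP _ Dx xe.
  have [_ _ fe' [p' pE'] [q' qE']] := fP _ Dy ye.
  rewrite -fxy in fe' pE' qE'; have [e'J e'e' _ _] := EP _ ye.
  have [|w wE] := chief_stable mulA KI (b := p') fJ; first by rewrite pE'.
  have e'f : E y ** f x = f x by rewrite -wE pE' mulA e'e'.
  have e'e : E y ** E x = E x by rewrite -pE mulA e'f.
  by rewrite -e'e -{1}qE' -mulA fe.
(* A point of [D] without an idempotent is the only point of [D], so its default colour only has to
   lie in the J-class. *)
have fJ x : D x -> f x \in K :\: I.
  move=> Dx; have [xe|nxe] := pselect (has_idem x).
    by have [] := fP x Dx xe.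
  by rewrite /f; case: pselect => //= nxe2; exact: aJ.
exists f; split=> // c.
have main x y : D x -> D y -> (x < y)%O -> f x = c -> f y = c ->
    sigma x y = E x /\ E x ** E x = E x.
  move=> Dx Dy lt fx fy.
  have xe := idem_at_lt Dx Dy lt; have ye := idem_at_gt Dy Dx lt.
  have fxy : f x = f y by rewrite fx.
  have exy := Einj _ _ Dx Dy xe ye fxy.
  have [eJ ee axe es] := EP _ xe; split=> //.
  have [_ fxE fe _ [q qE]] := fP _ Dx xe; have [_ fyE _ _ _] := fP _ Dy ye.
  have fb : f x ** sigma x y = f x by rewrite {2}fxy fxE fyE -exy -mulA aM.
  by rewrite -(es _ Dy lt) -{1}qE -mulA fb qE.
have [[x [y [Dx Dy lt fx fy]]]|no] :=
  pselect (exists x y, [/\ D x, D y, (x < y)%O, f x = c & f y = c]); last first.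
  by exists c => x y Dx Dy lt fx fy; case: no; exists x, y.
exists (E x) => x' y' Dx' Dy' lt' fx' fy'; rewrite -(Einj x' x) ?fx' ?fx //.
- exact: main.
- exact: idem_at_lt lt'.
- exact: idem_at_lt lt.
Qed.

End Smooth.

(** * Colouring the points that have a base in [Y] *)

(** Points of [Y] will receive smaller split values, so a colour has to be consistent only on
    intervals avoiding [Y]; e may change with the interval. *)
Definition locally_coloured (S : finType) (mul : S -> S -> S) (J : {set S})
    (d : Order.disp_t) (alpha : orderType d) (sigma : alpha -> alpha -> S)
    (Y D : alpha -> Prop) (f : alpha -> S) :=
  (forall x, D x -> f x \in J) /\
  forall l r, (forall z, Y z -> (l <= z)%O -> (z <= r)%O -> False) ->
  forall c, exists e, forall x y, D x -> D y ->
    (l <= x)%O -> (x < y)%O -> (y <= r)%O -> f x = c -> f y = c ->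
    sigma x y = e /\ mul e e = e.

Section Above.
Variables (S : finType) (mul : S -> S -> S) (K I : {set S}).
Hypotheses (mulA : associative mul) (KI : chief mul K I).
Local Notation "a ** b" := (mul a b) (at level 40, left associativity).
Variables (d : Order.disp_t) (alpha : orderType d).
Variable sigma : alpha -> alpha -> S.
Hypothesis sigmaM : is_labelling mul sigma.
Variable X : alpha -> Prop.
Hypothesis sigmaK : forall x y, X x -> X y -> (x < y)%O -> sigma x y \in K.

(** For each base y, [smooth_colouring] applies with [sigma y] as [a]. An interval avoiding [Y]
    involves only one base, so the separate colourings never clash there. *)
Lemma coloured_above (Y : alpha -> Prop) : (forall x, Y x -> X x) ->
  (forall x y, Y x -> Y y -> (x < y)%O -> sigma x y \in I) ->
  exists f, locally_coloured mul (K :\: I) sigma Y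
    (fun x => X x /\ exists y, [/\ Y y, (y < x)%O & sigma y x \notin I]) f.
Proof.
move=> YX sigmaI; pose D y x := [/\ X x, (y < x)%O & sigma y x \notin I].
pose good y f := (forall x, D y x -> f x \in K :\: I) /\
  forall c, exists e, forall x z, D y x -> D y z -> (x < z)%O ->
    f x = c -> f z = c -> sigma x z = e /\ e ** e = e.
have [F FP] : {F : alpha -> alpha -> S & forall y, Y y -> good y (F y)}.
  apply: (@choice _ _ (fun y f => Y y -> good y f)) => y.
  have [Yy|nYy] := pselect (Y y); last by exists (fun=> sigma y y).
  have [|||f fP] :=
    smooth_colouring (D := D y) (a := sigma y) mulA KI sigmaM.
  - by move=> x [Xx lt nI]; rewrite inE nI sigmaK //; exact: YX.
  - by move=> x z [Xx _ _] [Xz _ _]; exact: sigmaK.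
  - by move=> x z [_ lt _] _ lt'; exact: sigmaM.
  by exists f.
have [B BP] : {B : alpha -> alpha &
    forall x, (exists y, Y y /\ D y x) -> Y (B x) /\ D (B x) x}.
  apply: (@choice _ _ (fun x y =>
    (exists y, Y y /\ D y x) -> Y y /\ D y x)) => x.
  have [[y Dy]|nD] := pselect (exists y, Y y /\ D y x); first by exists y.
  by exists x.
have DB x : (X x /\ exists y, [/\ Y y, (y < x)%O & sigma y x \notin I]) ->
    Y (B x) /\ D (B x) x.
  by move=> [Xx [y [Yy lt nI]]]; apply: BP; exists y.
exists (fun x => F (B x) x); split=> [x /DB[YB DBx]|l r noY c].
  by have [FJ _] := FP _ YB; exact: FJ.
(* Two distinct bases would both lie before l, and their label is in I. *)
have Ble x z : Y (B x) -> D (B x) x -> Y (B z) -> D (B z) z ->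
    (l <= x)%O -> (x <= r)%O -> (l <= z)%O -> (z <= r)%O ->
    (B x < B z)%O -> False.
  move=> Yx [Xx ltx nIx] Yz [Xz ltz nIz] lx xr lz zr BB.
  have Bzx : (B z < x)%O.
    apply: lt_le_trans lx; rewrite ltNge; apply/negP=> lB.
    by apply: (noY _ Yz lB); exact: le_trans (ltW ltz) zr.
  move/negP: nIx; apply; rewrite -(sigmaM BB Bzx).
  have [_ idI _] := KI.
  by have [] := idI _ (sigma (B z) x) (sigmaI _ _ Yx Yz BB).
have Beq x z : Y (B x) -> D (B x) x -> Y (B z) -> D (B z) z ->
    (l <= x)%O -> (x <= r)%O -> (l <= z)%O -> (z <= r)%O -> B x = B z.
  move=> *; case: (ltgtP (B x) (B z)) => // lt; exfalso.
    exact: (Ble x z).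
  exact: (Ble z x).
have [[x0 [YB0 D0 lx0 x0r]]|no] :=
  pselect (exists x, [/\ Y (B x), D (B x) x, (l <= x)%O & (x <= r)%O]);
  last first.
  exists c => x z /DB[YB DBx] _ lx lt zr _ _; case: no; exists x; split=> //.
  exact: le_trans (ltW lt) zr.
have [_ /(_ c)[e eP]] := FP _ YB0.
exists e => x z /DB[YBx Dx] /DB[YBz Dz] lx lt zr.
have xr := le_trans (ltW lt) zr; have lz := le_trans lx (ltW lt).
have ex := Beq _ _ YBx Dx YB0 D0 lx xr lx0 x0r.
have ez := Beq _ _ YBz Dz YB0 D0 lz zr lx0 x0r.
by rewrite ex in Dx *; rewrite ez in Dz *; exact: eP.
Qed.

(** The J-class is now all of [K]. A fictitious base below [x0], with an arbitrary label [a0] to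
    [x0], provides the map [a]. *)
Lemma coloured_kernel (Y : alpha -> Prop) x0 : I = set0 -> X x0 ->
  K != set0 ->
  exists f, locally_coloured mul (K :\: I) sigma Y
    (fun x => X x /\ (x0 <= x)%O) f.
Proof.
move=> I0 X0 /set0Pn[a0 a0K].
pose a x := if x == x0 then a0 else a0 ** sigma x0 x.
have [|||f [fJ fP]] :=
  smooth_colouring (D := fun x => X x /\ (x0 <= x)%O) (a := a) mulA KI sigmaM.
- move=> x _; rewrite inE I0 inE /= /a; case: eqP => // _.
  by have [idK _ _] := KI; have [] := idK _ (sigma x0 x) a0K.
- by move=> x y [Xx _] [Xy _]; exact: sigmaK.
- move=> x y [Xx lex] [Xy ley] lt; rewrite /a (gt_eqF (le_lt_trans lex lt)).
  case: eqP => [->//|/eqP neq]; rewrite -mulA sigmaM //.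
  by rewrite lt_neqAle eq_sym neq.
exists f; split=> // l r _ c; have [e eP] := fP c; exists e.
by move=> x y Dx Dy _ lt _; exact: eP.
Qed.

End Above.

(** * Dual statements, from the reversed order and the opposite semigroup *)

Section Below.
Variables (S : finType) (mul : S -> S -> S) (K I : {set S}).
Hypotheses (mulA : associative mul) (KI : chief mul K I).
Variables (d : Order.disp_t) (alpha : orderType d).
Variable sigma : alpha -> alpha -> S.
Hypothesis sigmaM : is_labelling mul sigma.
Variable X : alpha -> Prop.
Hypothesis sigmaK : forall x y, X x -> X y -> (x < y)%O -> sigma x y \in K.

Let sigma' (x y : alpha^d) : S := sigma y x.

Let sigmaM' : is_labelling (opp_mul mul) sigma'.
Proof. by move=> x y z xy yz; exact: (sigmaM yz xy). Qed.

Let sigmaK' (x y : alpha^d) : X x -> X y -> (x < y)%O -> sigma' x y \in K.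
Proof. by move=> Xx Xy lt; exact: (sigmaK Xy Xx lt). Qed.

Let locally_coloured_dual J (Y D : alpha -> Prop) f :
  @locally_coloured _ (opp_mul mul) J _ alpha^d sigma' Y D f ->
  locally_coloured mul J sigma Y D f.
Proof.
case=> fJ fP; split=> // l r noY c.
have [|e eP] := fP r l _ c; first by move=> z Yz rz zl; exact: (noY z).
exists e => x y Dx Dy lx lt yr fx fy; exact: (eP y x).
Qed.

Lemma coloured_below (Y : alpha -> Prop) : (forall x, Y x -> X x) ->
  (forall x y, Y x -> Y y -> (x < y)%O -> sigma x y \in I) ->
  exists f, locally_coloured mul (K :\: I) sigma Y
    (fun x => X x /\ exists y, [/\ Y y, (x < y)%O & sigma x y \notin I]) f.
Proof.
move=> YX sigmaI.
have [|f fP] :=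
  coloured_above (opp_mulA mulA) (chief_opp mulA KI) sigmaM' sigmaK' YX.
  by move=> x y Yx Yy lt; exact: (sigmaI y x).
by exists f; apply: locally_coloured_dual.
Qed.

Lemma coloured_kernel_below (Y : alpha -> Prop) x0 : I = set0 -> X x0 ->
  K != set0 ->
  exists f, locally_coloured mul (K :\: I) sigma Y
    (fun x => X x /\ (x <= x0)%O) f.
Proof.
move=> I0 X0 K0.
have [f fP] := coloured_kernel (opp_mulA mulA) (chief_opp mulA KI)
  sigmaM' sigmaK' Y I0 X0 K0.
by exists f; apply: locally_coloured_dual.
Qed.

End Below.

(** * Choice of the subset [Y] *)

Lemma well_founded_lt (d : Order.disp_t) (alpha : orderType d) :
  well_order (<=%O : rel alpha) -> well_founded (fun x y : alpha => (x < y)%O).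
Proof.
move=> wo x; apply: contrapT => nx.
have [|z [[zA zmin] _]] :=
  wo [pred x | `[< ~ Acc (fun x y : alpha => (x < y)%O) x >]].
  by exists x; rewrite inE; apply/asboolP.
move: zA; rewrite inE => /asboolP; apply; constructor=> y lt.
apply: contrapT => ny; have := zmin y; rewrite inE => /(_ (asboolT ny)).
by rewrite leNgt lt.
Qed.

(* The flag b tells whether labels to the right are also allowed to witness the
   maximality of Y; in a well-order the greedy choice of Y makes them useless. *)
Lemma sparse_cover (b : bool) (d : Order.disp_t) (alpha : orderType d)
    (S : finType) (I : {set S}) (sigma : alpha -> alpha -> S)
    (X : alpha -> Prop) :
  (b = false -> well_order (<=%O : rel alpha)) ->
  exists Y : alpha -> Prop, [/\ forall x, Y x -> X x,
    forall x y, Y x -> Y y -> (x < y)%O -> sigma x y \in I &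
    forall x, X x -> [\/ Y x,
      exists y, [/\ Y y, (y < x)%O & sigma y x \notin I] |
      b /\ exists y, [/\ Y y, (x < y)%O & sigma x y \notin I]]].
Proof.
case: b => [_|/(_ erefl) /well_founded_lt wf]; last first.
  (* Greedy recursion: x is kept exactly when its labels from all earlier kept points lie in [I]. *)
  pose step x (rec : forall y, (y < x)%O -> Prop) :=
    X x /\ forall y (lt : (y < x)%O), rec y lt -> sigma y x \in I.
  pose Y := Fix wf (fun=> Prop) step.
  have YE x : Y x = (X x /\ forall y, (y < x)%O -> Y y -> sigma y x \in I).
    rewrite /Y Fix_eq // => {}x f g fg; congr (_ /\ _).
    by apply: eq_forall => y; apply: eq_forall => lt; rewrite fg.
  exists Y; split=> [x|x y Yx|x Xx]; first by rewrite YE => -[].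
    by rewrite YE => -[_ h] lt; exact: h.
  have [Yx|nYx] := pselect (Y x); first exact: Or31.
  apply: Or32; apply: contrapT => no; apply: nYx; rewrite YE.
  split=> // y lt Yy.
  by apply: contrapT => /negP nI; apply: no; exists y.
pose P (Y : set alpha) := (forall x, Y x -> X x) /\
  (forall x y, Y x -> Y y -> (x < y)%O -> sigma x y \in I).
have [|Y [[YX YI] Ymax]] := @Zorn_bigcup alpha P.
  move=> F FP Ftot; split=> [x [A FA Ax]|x y [A FA Ax] [B FB By] lt].
    by have [AX _] := FP _ FA; exact: AX.
  have [AB|BA] := Ftot A B FA FB.
    by have [_ h] := FP _ FB; apply: h => //; exact: AB.
  by have [_ h] := FP _ FA; apply: h => //; exact: BA.
exists Y; split=> // x Xx.
have [Yx|nYx] := pselect (Y x); first exact: Or31.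
have [dn|ndn] := pselect (exists y, [/\ Y y, (y < x)%O & sigma y x \notin I]).
  exact: Or32.
apply: Or33; split=> //; apply: contrapT => nup.
(* Without a witness on either side, x could be added to the maximal [Y]. *)
apply: (Ymax (fun y => Y y \/ y = x)).
  split=> [y|]; first by left.
  by move=> /(_ x (or_intror erefl)).
split=> [y [/YX//|->//]|y z [Yy|->] [Yz|->]]; last by rewrite ltxx.
- exact: YI.
- by move=> lt; apply: contrapT => /negP nI; apply: ndn; exists y.
- by move=> lt; apply: contrapT => /negP nI; apply: nup; exists z.
Qed.

(** * Extending a split from [Y] to [X], and the induction on ideals *)

Definition split_on (T : Type) (X : T -> Prop) (N : nat) (s : T -> nat) :=
  forall x, X x -> 1 <= s x <= N.

(* The interval [l, r] stands for the convex hull of the points compared in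
   [ramseyan]. *)
Definition ramseyan_on (d : Order.disp_t) (alpha : orderType d) (S : Type)
    (mul : S -> S -> S) (sigma : alpha -> alpha -> S) (X : alpha -> Prop)
    (s : alpha -> nat) :=
  forall k l r, (forall z, X z -> (l <= z)%O -> (z <= r)%O -> k <= s z) ->
  exists e, forall x y, X x -> X y -> (l <= x)%O -> (x < y)%O -> (y <= r)%O ->
    s x = k -> s y = k -> sigma x y = e /\ mul e e = e.

(** [Y] keeps the values up to h, [D1] takes the next |J| values, and [D2] another |J| if b holds.
    At a level k <= h only points of [Y] are compared; at k > h the interval avoids [Y], so the
    local colourings apply. *)
Lemma extend_split (b : bool) (d : Order.disp_t) (alpha : orderType d)
    (S : finType) (mul : S -> S -> S) (sigma : alpha -> alpha -> S)
    (J : {set S}) (X Y D1 D2 : alpha -> Prop) (f1 f2 : alpha -> S)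
    (h : nat) (sY : alpha -> nat) :
  (forall x, Y x -> X x) ->
  (forall x, X x -> [\/ Y x, D1 x | b /\ D2 x]) ->
  locally_coloured mul J sigma Y D1 f1 ->
  locally_coloured mul J sigma Y D2 f2 ->
  split_on Y h sY -> ramseyan_on mul sigma Y sY ->
  exists s, split_on X (h + b.+1 * #|J|) s /\ ramseyan_on mul sigma X s.
Proof.
move=> YX cover [f1J f1P] [f2J f2P] sYh sYR.
pose col (f : alpha -> S) x := index (f x) (enum J).
have col_lt (f : alpha -> S) x : f x \in J -> col f x < #|J|.
  by move=> fJ; rewrite cardE index_mem mem_enum.
have colE (f : alpha -> S) x c0 : f x \in J -> nth c0 (enum J) (col f x) = f x.
  by move=> fJ; rewrite nth_index // mem_enum.
(* Indices in [enum J] start at 0, hence the successors that keep the bands of values disjoint. *)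
pose s x := if pselect (Y x) then sY x else
  if pselect (D1 x) then h + (col f1 x).+1 else h + #|J| + (col f2 x).+1.
have sYE x : Y x -> s x = sY x by rewrite /s; case: pselect.
have s1E x : ~ Y x -> D1 x -> s x = h + (col f1 x).+1.
  by rewrite /s; case: pselect => // ?; case: pselect.
have s2E x : ~ Y x -> ~ D1 x -> s x = h + #|J| + (col f2 x).+1.
  by rewrite /s; case: pselect => // ?; case: pselect.
have cases x : X x -> [\/ Y x, [/\ ~ Y x, D1 x & s x = h + (col f1 x).+1] |
    [/\ ~ Y x, b, D2 x & s x = h + #|J| + (col f2 x).+1]].
  move=> Xx; have [Yx|nYx] := pselect (Y x); first exact: Or31.
  have [D1x|nD1x] := pselect (D1 x).
    by apply: Or32; split=> //; exact: s1E.
  by apply: Or33; case: (cover x Xx) => // -[bT D2x]; split=> //; exact: s2E.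
have low x : X x -> s x <= h -> Y x.
  move=> /cases[//|[_ _ ->]|[_ _ _ ->]];
    by rewrite ?addnS ltnNge -?addnA leq_addr.
exists s; split=>
  [x /cases[Yx|[_ /f1J/col_lt lt ->]|[_ bT /f2J/col_lt lt ->]]|k l r win].
- have /andP[s1 sh] := sYh x Yx; rewrite sYE // s1 /=.
  exact: leq_trans sh (leq_addr _ _).
- by rewrite addnS /= -addnS leq_add2l (leq_trans lt) // mulSn leq_addr.
- by rewrite addnS /= -addnS -addnA leq_add2l bT mulSn mul1n leq_add2l.
have [kh|hk] := leqP k h.
  have [|e eP] := sYR k l r.
    by move=> z Yz lz zr; rewrite -sYE //; apply: win => //; exact: YX.
  exists e => x y Xx Xy lx lt yr sx sy.
  have Yx : Y x by apply: low; rewrite ?sx.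
  have Yy : Y y by apply: low; rewrite ?sy.
  by apply: eP; rewrite // -sYE.
have noY z : Y z -> (l <= z)%O -> (z <= r)%O -> False.
  move=> Yz lz zr; have := win z (YX _ Yz) lz zr; rewrite sYE //.
  by have /andP[_ sh] := sYh z Yz; rewrite leqNgt (leq_ltn_trans sh).
have [kJ|Jk] := leqP k (h + #|J|).
  have D1k x : X x -> (l <= x)%O -> (x <= r)%O -> s x = k ->
      D1 x /\ f1 x = nth (f1 l) (enum J) (k - h.+1).
    move=> /cases[Yx lx xr|[_ D1x ->] _ _ <-|[_ _ _ ->] _ _ sk].
    - by case: (noY x).
    - by split=> //; rewrite addnS subSS addKn colE //; exact: f1J.
    - by move: kJ; rewrite -sk addnS ltnNge leq_addr.
  have [e eP] := f1P l r noY (nth (f1 l) (enum J) (k - h.+1)).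
  exists e => x y Xx Xy lx lt yr sx sy.
  have [D1x f1x] := D1k x Xx lx (le_trans (ltW lt) yr) sx.
  have [D1y f1y] := D1k y Xy (le_trans lx (ltW lt)) yr sy.
  exact: eP.
have D2k x : X x -> (l <= x)%O -> (x <= r)%O -> s x = k ->
    D2 x /\ f2 x = nth (f2 l) (enum J) (k - (h + #|J|).+1).
  move=> /cases[Yx lx xr|[_ D1x ->] _ _ sk|[_ _ D2x ->] _ _ <-].
  - by case: (noY x).
  - by move: Jk; rewrite -sk ltn_add2l ltnS leqNgt col_lt //; exact: f1J.
  - by split=> //; rewrite addnS subSS addKn colE //; exact: f2J.
have [e eP] := f2P l r noY (nth (f2 l) (enum J) (k - (h + #|J|).+1)).
exists e => x y Xx Xy lx lt yr sx sy.
have [D2x f2x] := D2k x Xx lx (le_trans (ltW lt) yr) sx.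
have [D2y f2y] := D2k y Xy (le_trans lx (ltW lt)) yr sy.
exact: eP.
Qed.

Lemma ramseyan_split_on (b : bool) (d : Order.disp_t) (alpha : orderType d)
    (S : finType) (mul : S -> S -> S) (sigma : alpha -> alpha -> S) :
  associative mul -> is_labelling mul sigma ->
  (b = false -> well_order (<=%O : rel alpha)) ->
  forall (K : {set S}) (X : alpha -> Prop), ideal mul K -> K != set0 ->
  (forall x y, X x -> X y -> (x < y)%O -> sigma x y \in K) ->
  exists s, split_on X (b.+1 * #|K|) s /\ ramseyan_on mul sigma X s.
Proof.
move=> mulA sigmaM wo K; have [n] := ubnP #|K|.
elim: n K => // n IH K leKn X idK K0 sigmaK.
have [I [KI ltIK]] := exists_chief mulA idK K0.
have cK : #|K| = #|I| + #|K :\: I|.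
  by rewrite -(cardsID I K) (setIidPr (proper_sub ltIK)).
rewrite cK mulnDr.
have [I0|In0] := eqVneq I set0.
  have [[p Xp]|noX] := pselect (exists x, X x); last first.
    exists (fun=> 0); split=> [x Xx|k l r _]; first by case: noX; exists x.
    by exists (sigma l l) => x y Xx; case: noX; exists x.
  (* Any point splits [X] if both sides may be coloured; otherwise the minimum leaves nothing
     below. *)
  have [x0 [X0 x0min]] : exists x0,
      X x0 /\ (b = false -> forall x, X x -> (x0 <= x)%O).
    case: (b) wo => [_|/(_ erefl) wf]; first by exists p.
    have [|x0 [[X0 x0min] _]] := wf [pred x | `[< X x >]].
      by exists p; rewrite inE; apply/asboolP.
    exists x0; split=> [|_ x Xx]; first by move: X0; rewrite inE => /asboolP.
    by apply: x0min; rewrite inE; apply/asboolP.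
  pose Y (x : alpha) := False.
  have [f1 f1P] := coloured_kernel mulA KI sigmaM sigmaK Y I0 X0 K0.
  have [f2 f2P] := coloured_kernel_below mulA KI sigmaM sigmaK Y I0 X0 K0.
  apply: (extend_split (sY := fun=> 0) _ _ f1P f2P) => // [x Xx|k l r _].
    have [le|lt] := leP x0 x; first exact: Or32.
    apply: Or33; case: (b) x0min => [_|/(_ erefl x Xx)]; last first.
      by rewrite leNgt lt.
    by split=> //; split=> //; exact: ltW.
  by exists (sigma l l).
have [Y [YX YI cover]] := sparse_cover I sigma X wo.
have [f1 f1P] := coloured_above mulA KI sigmaM sigmaK YX YI.
have [f2 f2P] := coloured_below mulA KI sigmaM sigmaK YX YI.
have [_ idI _] := KI.
have [|s [sh sR]] := IH I _ Y idI In0 YI.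
  by rewrite -ltnS (leq_trans _ leKn) // ltnS proper_card.
apply: (extend_split _ _ f1P f2P sh sR) => // x Xx.
case: (cover x Xx) => [Yx|D1x|[bT D2x]].
- exact: Or31.
- exact: Or32.
- exact: Or33.
Qed.

(** * Return to neighbours, and the two bounds *)

Lemma ramseyan_split (b : bool) (d : Order.disp_t) (alpha : orderType d)
    (S : finType) (mul : SemiGroup.law S) (sigma : alpha -> alpha -> S) :
  0 < #|S| -> additive_labelling mul sigma ->
  (b = false -> well_order (<=%O : rel alpha)) ->
  exists s, is_split (b.+1 * #|S|) s /\ ramseyan mul sigma s.
Proof.
move=> S0 sigmaM wo.
have [|||s [sh sR]] := @ramseyan_split_on b _ _ _ mul sigma
  (@SemiGroup.opA _ mul) sigmaM wo [set: S] (fun=> True).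
- by move=> a b' _; rewrite !inE.
- by rewrite -card_gt0 cardsT.
- by move=> x y _ _ _; rewrite inE.
rewrite cardsT in sh; exists s; split=> [x|k x y x' y' lt lt' nb].
  exact: sh.
(* Both ends of the convex hull are among the four points, so a single neighbour condition bounds s
   from below on the whole hull. *)
have minx : Order.min x x' \in [:: x; y; x'; y'].
  by case: (leP x x') => _; rewrite !inE eqxx ?orbT.
have maxy : Order.max y y' \in [:: x; y; x'; y'].
  by case: (leP y y') => _; rewrite !inE eqxx ?orbT.
have [e eP] : exists e, forall u v, True -> True -> (Order.min x x' <= u)%O ->
    (u < v)%O -> (v <= Order.max y y')%O -> s u = k -> s v = k ->
    sigma u v = e /\ mul e e = e.
  apply: sR => z _ lz zr; have [_ _] := nb _ _ minx maxy; apply.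
  by rewrite ge_min lz le_max zr orbT.
have sk u : u \in [:: x; y; x'; y'] -> s u = k.
  by move=> uin; have [] := nb u u uin uin.
have [| | | | | -> ->] := eP x y I I;
  rewrite ?ge_min ?le_max ?lexx ?orbT ?sk ?inE ?eqxx ?orbT //.
by have [| | | | | ->] := eP x' y' I I;
  rewrite ?ge_min ?le_max ?lexx ?orbT ?sk ?inE ?eqxx ?orbT.
Qed.

Theorem theorem4 (d : Order.disp_t) (alpha : orderType d)
    (S : finType) (mul : SemiGroup.law S) (sigma : alpha -> alpha -> S) :
  (0 < #|S|)%N ->
  complete_order alpha ->
  additive_labelling mul sigma ->
  (exists (N : nat) (s : alpha -> nat),
      [/\ (N <= 3 * #|S|)%N, is_split N s & ramseyan mul sigma s]) /\
  (well_order (<=%O : rel alpha) ->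
   exists (N : nat) (s : alpha -> nat),
      [/\ (N <= #|S|)%N, is_split N s & ramseyan mul sigma s]).
Proof.
move=> S0 _ sigmaM; split=> [|wo].
  (* Colouring on both sides gives height 2|S|, which is within 3|S|. *)
  have [//|s [sN sR]] := @ramseyan_split true _ _ _ mul sigma S0 sigmaM.
  by exists (2 * #|S|), s; split=> //; rewrite leq_mul2r orbT.
have [//|s [sN sR]] := @ramseyan_split false _ _ _ mul sigma S0 sigmaM.
by exists #|S|, s; split=> //; rewrite mul1n in sN.
Qed.
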